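(* Let $N>0$ be real and $n\ge0$ an integer. Let $X$ be a real random variable whose probability density is proportional to \[ f_{n,N}(X)=\left(1+\frac{X^2}{N}\right)^{-(N+1+n)}\bigl(H_n^N(X)\bigr)^2,\qquad X\in\mathbb{R}. \] Then the random variable \[ Y=\frac{X/\sqrt{N}}{\sqrt{1+\frac{X^{2}}{N}}} \] has, on $(-1,1)$, a probability density proportional to \[ g_{n,\nu}(Y)=(1-Y^2)^{\nu-\frac12}\bigl(C_n^{\nu}(Y)\bigr)^2\quad\text{with }\nu=N. \]
   Context: For $N>0$ and integer $n\ge0$, the relativistic Hermite polynomial is $H_n^N(X)=(-1)^n(1+\frac{X^2}{N})^{N+n}\frac{d^n}{dX^n}(1+\frac{X^2}{N})^{-N}$. For $\nu\neq0$, the Gegenbauer polynomial is $C_n^{\nu}(X)=\alpha_{n,\nu}(-1)^n(1-X^2)^{\frac12-\nu}\frac{d^n}{dX^n}(1-X^2)^{n+\nu-\frac12}$ with $\alpha_{n,\nu}=\frac{(2\nu)_n}{2^n n!(\nu+\frac12)_n}$, $(a)_n$ the Pochhammer symbol. Equivalently $f_{n,N}=|h_n^N|^2$ with $h_n^N(X)=(1+\frac{X^2}{N})^{-\frac{N+1+n}{2}}H_n^N(X)$ and $g_{n,\nu}=|\mathfrak{c}_n^{\nu}|^2$ with $\mathfrak{c}_n^{\nu}(Y)=(1-Y^2)^{\frac{\nu}{2}-\frac14}C_n^{\nu}(Y)$. *)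

(* Defs.v *)
From HB Require Import structures.
From mathcomp Require Import all_boot all_order all_algebra.
From mathcomp Require Import all_classical all_reals all_analysis.
Set Implicit Arguments. Unset Strict Implicit. Unset Printing Implicit Defensive.
Import Order.TTheory GRing.Theory Num.Theory.
Local Open Scope ring_scope.
Local Open Scope classical_set_scope.

Section Defs.
Variable R : realType.

Definition pochhammer (a : R) (n : nat) : R := \prod_(k < n) (a + k%:R).

(* relativistic Hermite polynomial H_n^N(X) via its Rodrigues formula *)
Definition relHermite (N : R) (n : nat) (x : R) : R :=
  (-1) ^+ n * powR (1 + x ^+ 2 / N) (N + n%:R)
  * derive1n n (fun t : R => powR (1 + t ^+ 2 / N) (- N)) x.

Definition f_dens (n : nat) (N : R) (x : R) : R :=
  powR (1 + x ^+ 2 / N) (- (N + 1 + n%:R)) * (relHermite N n x) ^+ 2.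

Definition alpha_geg (n : nat) (nu : R) : R :=
  pochhammer (2 * nu) n / (2 ^+ n * n`!%:R * pochhammer (nu + 1/2) n).

(* Gegenbauer polynomial C_n^nu(X) via its Rodrigues formula *)
Definition gegenbauer (n : nat) (nu : R) (x : R) : R :=
  alpha_geg n nu * (-1) ^+ n * powR (1 - x ^+ 2) (1/2 - nu)
  * derive1n n (fun t : R => powR (1 - t ^+ 2) (n%:R + nu - 1/2)) x.

Definition g_dens (n : nat) (nu : R) (y : R) : R :=
  powR (1 - y ^+ 2) (nu - 1/2) * (gegenbauer n nu y) ^+ 2.

End Defs.

(* Main.v *)
(** Write phi x = (x / sqrt N) / sqrt (1 + x^2 / N), a diffeomorphism from the
    line onto ]-1, 1[, with 1 - phi^2 = 1 / (1 + x^2 / N) and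
    phi' = (1 + x^2 / N)^(-3/2) / sqrt N. Both Rodrigues formulas differentiate
    a power of a quadratic 1 + s t^2, and Leibniz' rule turns these derivatives
    into three-term recurrences. Comparing recurrences gives Nagel's identity
    H_n^N(x) = n! ((1 + x^2 / N) / N)^(n/2) C_n^N(phi x), hence
    f = K (g o phi) phi' for a positive constant K, and the theorem is a change
    of variables. *)
Require Import Defs.
From HB Require Import structures.
From mathcomp Require Import all_boot all_order all_algebra.
From mathcomp Require Import all_classical all_reals all_analysis.
From mathcomp Require Import measurable_realfun.
From mathcomp Require Import ring.
Import Order.TTheory GRing.Theory Num.Theory.
Import numFieldNormedType.Exports.
Local Open Scope ring_scope.
Local Open Scope classical_set_scope.

(** [rodrigues a s n] is the polynomial factor in
    D^n (1 + s t^2)^a = (1 + s t^2)^(a - n) * rodrigues a s n t. *)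
Fixpoint rodrigues {R : realType} (a s : R) (n : nat) (t : R) : R :=
  match n with
  | 0 => 1
  | m.+1 => match m with
    | 0 => 2 * s * a * t
    | k.+1 => 2 * s * (a - m%:R) * t * rodrigues a s m t
        + m%:R * s * (2 * a - k%:R) * (1 + t ^+ 2 * s) * rodrigues a s k t
    end
  end.

(** This is [n! C_n^nu], by the classical three-term recurrence. *)
Fixpoint ultraspherical {R : realType} (nu : R) (n : nat) (y : R) : R :=
  match n with
  | 0 => 1
  | m.+1 => match m with
    | 0 => 2 * nu * y
    | k.+1 => 2 * (m%:R + nu) * y * ultraspherical nu m y
        - m%:R * (k%:R + 2 * nu) * ultraspherical nu k y
    end
  end.

Arguments rodrigues : simpl nomatch.
Arguments ultraspherical : simpl nomatch.

(** * Algebra of the two polynomial families *)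

Section polynomials.
Context {R : realType}.
Implicit Types (a s t nu y : R) (n : nat).

Lemma rodriguesSS a s n t : rodrigues a s n.+2 t =
  2 * s * (a - n.+1%:R) * t * rodrigues a s n.+1 t
  + n.+1%:R * s * (2 * a - n%:R) * (1 + t ^+ 2 * s) * rodrigues a s n t.
Proof. by []. Qed.

Lemma ultrasphericalSS nu n y : ultraspherical nu n.+2 y =
  2 * (n.+1%:R + nu) * y * ultraspherical nu n.+1 y
  - n.+1%:R * (n%:R + 2 * nu) * ultraspherical nu n y.
Proof. by []. Qed.

(* Leibniz' rule for D^(n+1) w^(a+1) = D^n (2 s (a + 1) t w^a), w = 1 + s t^2. *)
Lemma rodrigues_raise a s n t : rodrigues (a + 1) s n.+1 t =
  2 * s * (a + 1) * (t * rodrigues a s n t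
    + n%:R * (1 + t ^+ 2 * s) * rodrigues a s n.-1 t).
Proof.
(* The recurrence has order two, so the induction carries two consecutive indices. *)
suff: rodrigues (a + 1) s n.+1 t = 2 * s * (a + 1) * (t * rodrigues a s n t
    + n%:R * (1 + t ^+ 2 * s) * rodrigues a s n.-1 t) /\
  rodrigues (a + 1) s n.+2 t = 2 * s * (a + 1) * (t * rodrigues a s n.+1 t
    + n.+1%:R * (1 + t ^+ 2 * s) * rodrigues a s n t) by case.
elim: n => [|n [IH0 IH1]]; first by split=> /=; ring.
split=> //; rewrite rodriguesSS IH1 IH0 rodriguesSS.
case: n {IH0 IH1} => [|n]; first by rewrite /=; ring.
rewrite rodriguesSS /= -[n.+3%:R]natr1 -[n.+2%:R]natr1 -[n.+1%:R]natr1.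
ring.
Qed.

(* The structure relation (n + 1) C_(n+1) = (n + 2 nu) y C_n - (1 - y^2) C_n',
   with C_n' = 2 nu C_(n-1)^(nu+1) substituted; it matches [rodrigues_raise]. *)
Lemma ultraspherical_raise nu n y : ultraspherical nu n.+1 y =
  (n%:R + 2 * nu) * y * ultraspherical nu n y
  - 2 * nu * n%:R * (1 - y ^+ 2) * ultraspherical (nu + 1) n.-1 y.
Proof.
suff: ultraspherical nu n.+1 y = (n%:R + 2 * nu) * y * ultraspherical nu n y
    - 2 * nu * n%:R * (1 - y ^+ 2) * ultraspherical (nu + 1) n.-1 y /\
  ultraspherical nu n.+2 y = (n.+1%:R + 2 * nu) * y * ultraspherical nu n.+1 y
    - 2 * nu * n.+1%:R * (1 - y ^+ 2) * ultraspherical (nu + 1) n y by case.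
elim: n => [|n [IH0 IH1]]; first by split=> /=; ring.
split=> //.
have n1 : n.+1%:R != 0 :> R by rewrite pnatr_eq0.
have n2 : n%:R + 1 != 0 :> R by rewrite natr1.
(* The induction hypotheses are solved for the terms of parameter [nu + 1], kept together with the
   factor 2 nu (1 - y^2), which may vanish. *)
have e1 : 2 * nu * (1 - y ^+ 2) * ultraspherical (nu + 1) n y =
    ((n.+1%:R + 2 * nu) * y * ultraspherical nu n.+1 y
     - ultraspherical nu n.+2 y) / n.+1%:R.
  by rewrite IH1; field.
have e0 : 2 * nu * n%:R * (1 - y ^+ 2) * ultraspherical (nu + 1) n.-1 y =
   (n%:R + 2 * nu) * y * ultraspherical nu n y - ultraspherical nu n.+1 y.
  by rewrite IH0; ring.
(* The three-term recurrence at parameter [nu + 1], multiplied by that factor; for n = 0 the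
   coefficient kills the [n.-1] term. *)
have eS : 2 * nu * (1 - y ^+ 2) * ultraspherical (nu + 1) n.+1 y =
    2 * (n.+1%:R + nu) * y
      * (2 * nu * (1 - y ^+ 2) * ultraspherical (nu + 1) n y)
    - (n.+1%:R + 2 * nu)
      * (2 * nu * n%:R * (1 - y ^+ 2) * ultraspherical (nu + 1) n.-1 y).
  case: n {IH0 IH1 e0 e1 n1 n2} => [|n]; first by rewrite /=; ring.
  rewrite ultrasphericalSS /= -[n.+2%:R]natr1 -[n.+1%:R]natr1.
  ring.
have -> : 2 * nu * n.+2%:R * (1 - y ^+ 2) * ultraspherical (nu + 1) n.+1 y =
  n.+2%:R * (2 * nu * (1 - y ^+ 2) * ultraspherical (nu + 1) n.+1 y) by ring.
rewrite eS e1 e0 ultrasphericalSS (ultrasphericalSS _ n).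
rewrite -[n.+2%:R]natr1 -[n.+1%:R]natr1.
by field.
Qed.

Lemma pochhammer_gt0 a n : 0 < a -> 0 < pochhammer a n.
Proof.
by move=> a0; apply: prodr_gt0 => k _; rewrite ltr_wpDr.
Qed.

Lemma pochhammerS a n : pochhammer a n.+1 = pochhammer a n * (a + n%:R).
Proof. by rewrite /pochhammer big_ord_recr. Qed.

Lemma pochhammer_recl a n : pochhammer a n.+1 = a * pochhammer (a + 1) n.
Proof.
rewrite /pochhammer big_ord_recl addr0; congr (_ * _).
by apply: eq_bigr => i _; rewrite -addrA nat1r.
Qed.

(** The exponent grows with [n], so the recurrence at fixed exponent does not apply. Instead
    [rodrigues_raise] and [ultraspherical_raise] both lead from (n + 1, nu) to (n, nu) and (n - 1,
    nu + 1), and it remains to compare Pochhammer factors. *)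
Lemma rodrigues_ultraspherical nu n y : 0 < nu ->
  rodrigues (n%:R + nu - 1 / 2) (-1) n y =
  (- 2) ^+ n * pochhammer (nu + 1 / 2) n / pochhammer (2 * nu) n
  * ultraspherical nu n y.
Proof.
move=> nu0.
(* Strong induction with [nu] generalized, since the second predecessor has parameter [nu + 1]. *)
suff H m : (m <= n)%N -> forall nu, 0 < nu ->
  rodrigues (m%:R + nu - 1 / 2) (-1) m y =
  (- 2) ^+ m * pochhammer (nu + 1 / 2) m / pochhammer (2 * nu) m
  * ultraspherical nu m y by exact: H.
elim: n m {nu nu0} => [|n IH] [|m] // mn nu nu0.
- by rewrite /pochhammer !big_ord0 /= expr0 invr1 !mulr1.
- by rewrite /pochhammer !big_ord0 /= expr0 invr1 !mulr1.
have -> : m.+1%:R + nu - 1 / 2 = m%:R + nu - 1 / 2 + 1 :> R.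
  by rewrite -natr1; ring.
rewrite rodrigues_raise (IH m) // ultraspherical_raise.
have p2 : pochhammer (2 * nu) m != 0 by rewrite gt_eqF ?pochhammer_gt0 ?mulr_gt0.
have m2 : 2 * nu + m%:R != 0 by rewrite gt_eqF// ltr_wpDr ?mulr_gt0.
case: m mn p2 m2 => [|m] mn p2 m2.
  by rewrite !pochhammerS /pochhammer !big_ord0 /=; field; rewrite gt_eqF.
have -> : rodrigues (m.+1%:R + nu - 1 / 2) (-1) m.+1.-1 y =
  rodrigues (m%:R + (nu + 1) - 1 / 2) (-1) m y.
  by congr (rodrigues _ _ _ _); rewrite -natr1; ring.
rewrite (IH m) ?addr_gt0// 1?ltnW//=.
rewrite [pochhammer (nu + 1/2) m.+2]pochhammerS.
rewrite [pochhammer (nu + 1/2) m.+1]pochhammer_recl.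
have -> : nu + 1 / 2 + 1 = nu + 1 + 1 / 2 :> R by ring.
have q2 : pochhammer (2 * nu + 1 + 1) m != 0.
  by rewrite gt_eqF ?pochhammer_gt0// !addr_gt0 ?mulr_gt0.
(* Parameter nu + 1 brings in (2 nu + 2)_m. To reach it, two factors are taken off the front of (2
   nu)_(m+2), whose last factor is divided out. *)
have E1 : pochhammer (2 * nu) m.+1 =
  2 * nu * (2 * nu + 1) * pochhammer (2 * nu + 1 + 1) m / (2 * nu + m.+1%:R).
  have -> : pochhammer (2 * nu) m.+1 = pochhammer (2 * nu) m.+2 / (2 * nu + m.+1%:R).
    by rewrite [pochhammer _ m.+2]pochhammerS mulfK.
  by rewrite !pochhammer_recl; ring.
rewrite [pochhammer (2 * nu) m.+2]pochhammerS E1.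
have -> : 2 * (nu + 1) = 2 * nu + 1 + 1 by ring.
have h1 : 2 * nu + 1 != 0 by rewrite gt_eqF// addr_gt0 ?mulr_gt0.
have h3 : 2 * nu + (m%:R + 1) != 0 by rewrite natr1.
rewrite -[m.+1%:R]natr1 !exprS /=.
by field; rewrite ?q2 ?h1 ?h3 ?(gt_eqF nu0).
Qed.

(** Nagel's identity up to normalization. The exponent is fixed here, and dividing the recurrence of
    [rodrigues] by the matching power of - q r gives that of [ultraspherical] at x q / r. *)
Lemma rodrigues_homogeneous (N q r x : R) n : r != 0 ->
  1 + x ^+ 2 * q ^+ 2 = r ^+ 2 ->
  rodrigues (- N) (q ^+ 2) n x = (- (q * r)) ^+ n * ultraspherical N n (x * q / r).
Proof.
move=> r0 xr.
suff: rodrigues (- N) (q ^+ 2) n x =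
    (- (q * r)) ^+ n * ultraspherical N n (x * q / r) /\
  rodrigues (- N) (q ^+ 2) n.+1 x =
    (- (q * r)) ^+ n.+1 * ultraspherical N n.+1 (x * q / r) by case.
elim: n => [|n [IH0 IH1]]; first by split=> /=; rewrite ?expr0 ?mulr1//; field.
split=> //; rewrite rodriguesSS IH1 IH0 xr ultrasphericalSS !exprS.
by rewrite -[n.+1%:R]natr1; field.
Qed.

End polynomials.

(** * Iterated derivatives of a power of a quadratic *)

Section rodrigues_formula.
Context {R : realType}.
Implicit Types (a s t : R) (n : nat).

Let scaleE (a b : R) : a *: b = a * b. Proof. by []. Qed.

Let is_derive_quadratic s t :
  is_derive t 1 (fun x : R => 1 + x ^+ 2 * s) (2 * t * s).
Proof.
have h := is_deriveD (is_derive_cst (1 : R) t 1)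
  (is_deriveZ s (is_deriveX 2 (is_derive_id t 1))).
rewrite [fun x => _](_ : _ = cst 1 + s *: ((@id R : R -> R) ^+ 2)); last first.
  by apply/funext => y; rewrite !fctE scaleE mulrC.
by apply: (is_derive_eq h); rewrite !scaleE /=; ring.
Qed.

(** As for Hermite polynomials, differentiation at fixed exponent lowers the degree and keeps the
    parameter; this follows by differentiating the recurrence. *)
Lemma is_derive_rodrigues a s n t : is_derive t 1 (rodrigues a s n)
  (n%:R * s * (2 * a - n%:R + 1) * rodrigues a s n.-1 t).
Proof.
suff H : is_derive t 1 (rodrigues a s n)
    (n%:R * s * (2 * a - n%:R + 1) * rodrigues a s n.-1 t) /\
  is_derive t 1 (rodrigues a s n.+1)
    (n.+1%:R * s * (2 * a - n.+1%:R + 1) * rodrigues a s n t).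
  exact: H.1.
elim: n => [|n [IH0 IH1]].
  split; first by rewrite !mul0r; exact: is_derive_cst.
  have h := is_deriveZ (2 * s * a) (is_derive_id t 1).
  by apply: (is_derive_eq h); rewrite scaleE [rodrigues _ _ _ _]/=; ring.
split=> //.
have h := is_deriveD
  (is_deriveZ (2 * s * (a - n.+1%:R)) (is_deriveM (is_derive_id t 1) IH1))
  (is_deriveZ (n.+1%:R * s * (2 * a - n%:R))
    (is_deriveM (is_derive_quadratic s t) IH0)).
rewrite [rodrigues a s n.+2](_ : _ =
  (2 * s * (a - n.+1%:R)) *: ((@id R : R -> R) * rodrigues a s n.+1) +
  (n.+1%:R * s * (2 * a - n%:R)) *:
    ((fun x : R => 1 + x ^+ 2 * s) * rodrigues a s n)); last first.
  by apply/funext => x; rewrite rodriguesSS !fctE !scaleE; ring.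
apply: (is_derive_eq h); rewrite !scaleE.
case: n {IH0 IH1 h} => [|n]; first by rewrite /=; ring.
rewrite rodriguesSS -[n.+3%:R]natr1 -[n.+2%:R]natr1 -[n.+1%:R]natr1.
by rewrite [n.+1.-1]/=; ring.
Qed.

Lemma is_derive_powR_quadratic a s t : 0 < 1 + t ^+ 2 * s ->
  is_derive t 1 (fun x : R => (1 + x ^+ 2 * s) `^ a)
    (a * (1 + t ^+ 2 * s) `^ (a - 1) * (2 * t * s)).
Proof.
move=> t0; have d1 := @is_derive1_powR _ a _ t0.
exact: (@is_derive1_comp _ (fun x : R => x `^ a) (fun x : R => 1 + x ^+ 2 * s)).
Qed.

Lemma continuous_powR_quadratic a s t : 0 < 1 + t ^+ 2 * s ->
  {for t, continuous (fun x : R => (1 + x ^+ 2 * s) `^ a)}.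
Proof.
move=> t0; have d := is_derive_powR_quadratic a s t t0.
exact/differentiable_continuous/derivable1_diffP.
Qed.

(** Write w = 1 + s t^2 and R_n for [rodrigues a s n]. By the product rule the next derivative is
    w^(a - n - 1) times 2 s (a - n) t R_n + w R_n', and [is_derive_rodrigues] makes this sum the
    recurrence for R_(n+1). *)
Lemma derive1n_powR_quadratic a s n t : 0 < 1 + t ^+ 2 * s ->
  derive1n n (fun x : R => (1 + x ^+ 2 * s) `^ a) t =
  (1 + t ^+ 2 * s) `^ (a - n%:R) * rodrigues a s n t.
Proof.
elim: n t => [|n IH] t t0; first by rewrite derive1n0 subr0 mulr1.
(* The induction hypothesis holds only where the quadratic is positive; by continuity this includes
   a neighbourhood of [t], enough for a derivative. *)
rewrite derive1nS derive1E (@near_eq_derive _ _ _ _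
  ((fun x : R => (1 + x ^+ 2 * s) `^ (a - n%:R)) * rodrigues a s n)); last first.
  near=> x; apply: IH; near: x.
  have : {for t, continuous (fun x : R => 1 + x ^+ 2 * s)}.
    have d := is_derive_quadratic s t.
    exact/differentiable_continuous/derivable1_diffP.
  by move=> /cvgr_gt /(_ _ t0).
have d1 := is_derive_powR_quadratic (a - n%:R) s t t0.
have d2 := is_derive_rodrigues a s n t.
rewrite derive_val /= /GRing.scale /=.
have -> : a - n.+1%:R = a - n%:R - 1 by rewrite -natr1; ring.
set h := 1 + t ^+ 2 * s.
have -> : h `^ (a - n%:R) = h * h `^ (a - n%:R - 1).
  rewrite -[X in X * _ `^ _]powRr1 ?(ltW t0)// -powRD.
    by congr (_ `^ _); ring.
  by apply/implyP => _; rewrite gt_eqF.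
case: n {IH d1 d2} => [|n]; first by rewrite /=; ring.
by rewrite rodriguesSS -/h /= -[n.+1%:R]natr1; ring.
Unshelve. all: by end_near. Qed.

End rodrigues_formula.

(** * Change of variables along an increasing C^1 bijection from the line onto ]l, r[ *)

Section change_of_variables.
Context {R : realType}.
Notation mu := (@lebesgue_measure R).
Variables (phi psi g : R -> R) (l r : R).
Hypothesis dphi : forall x, derivable phi x 1.
Hypothesis cphi' : continuous (derive1 phi).
Hypothesis phi'_gt0 : forall x, 0 < (derive1 phi) x.
Hypothesis phiI : forall x, phi x \in `]l, r[%R.
Hypothesis phiK : {in `]l, r[%R, cancel psi phi}.
Hypothesis mpsi : measurable_fun `]l, r[ psi.
Hypothesis cg : {in `]l, r[%R, continuous g}.
Hypothesis g_ge0 : {in `]l, r[%R, forall y, 0 <= g y}.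

Let h (x : R) : R := g (phi x) * derive1 phi x.

Let phi_cont : continuous phi.
Proof. by move=> x; exact/differentiable_continuous/derivable1_diffP. Qed.

Let phi_incr : {homo phi : x y / x < y}.
Proof.
move=> x y xy; apply: (@gtr0_derive1_lt_cc _ phi x y) => //.
- exact: continuous_subspaceT.
- by rewrite in_itv/= lexx ltW.
- by rewrite in_itv/= lexx ltW.
Qed.

Let phi_mono : {mono phi : x y / x < y}.
Proof. exact: leW_mono (le_mono phi_incr). Qed.

Let phi_le : {mono phi : x y / x <= y}.
Proof. exact: le_mono phi_incr. Qed.

Let h_cont : continuous h.
Proof.
move=> x; apply: continuousM; last exact: cphi'.
by apply: continuous_comp; [exact: phi_cont|exact: cg].
Qed.

Let h_ge0 x : 0 <= h x.
Proof. by rewrite mulr_ge0 ?g_ge0// ltW. Qed.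

Let mh : measurable_fun [set: R] (EFin \o h).
Proof. by apply/measurable_EFinP; exact: continuous_measurable_fun. Qed.

Let mg : measurable_fun `]l, r[ (EFin \o g).
Proof.
apply/measurable_EFinP; apply: open_continuous_measurable_fun.
  exact: interval_open.
by move=> x /set_mem; exact: cg.
Qed.

(** [m2] is the image under [psi] of the measure with density [g] on ]l, r[, so that both measures
    live on the line. *)
Let m1 (B : set (measurableTypeR R)) := (\int[mu]_(x in B) (h x)%:E)%E.
Let m2 (B : set (measurableTypeR R)) :=
  (\int[mu]_(y in `]l, r[ `&` psi @^-1` B) (g y)%:E)%E.

Let mpre (B : set R) : measurable B -> measurable (`]l, r[ `&` psi @^-1` B).
Proof. by move=> mB; exact: mpsi. Qed.

Let m1_0 : m1 set0 = 0%E. Proof. exact: integral_set0. Qed.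
Let m1_ge0 B : (0 <= m1 B)%E.
Proof. by apply: integral_ge0 => x _; rewrite lee_fin. Qed.
Let m1_sadd : semi_sigma_additive m1.
Proof.
by apply: semi_sigma_additive_nng_induced => // x; rewrite lee_fin.
Qed.

Let m2_0 : m2 set0 = 0%E.
Proof. by rewrite /m2 preimage_set0 setI0 integral_set0. Qed.
Let m2_ge0 B : (0 <= m2 B)%E.
Proof. by apply: integral_ge0 => y [? _]; rewrite lee_fin g_ge0. Qed.
Let m2_sadd : semi_sigma_additive m2.
Proof.
move=> /= F mF tF mUF; rewrite /m2 preimage_bigcup setI_bigcupr.
rewrite ge0_integral_bigcup//=.
- apply: is_cvg_ereal_nneg_natsum_cond => // n _ _; exact: m2_ge0.
- by move=> k; exact: (mpre _ (mF k)).
- apply: measurable_funS mg => //.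
  by apply: bigcup_sub => k _ y [].
- by move=> y [k _ [? _]]; rewrite lee_fin g_ge0.
- move=> i j _ _ [y [[_ yi] [_ yj]]].
  by apply: tF => //; exists (psi y).
Qed.

Let m12_itv (a b : R) : a < b -> m1 `]a, b] = m2 `]a, b].
Proof.
move=> ab; rewrite /m1 /m2.
have -> : `]l, r[ `&` psi @^-1` `]a, b] = `]phi a, phi b].
  apply/seteqP; split => y /=; rewrite !in_itv/=.
    by move=> [ylr]; rewrite -phi_mono -(phi_le _ b) phiK.
  move=> /andP[ay yb].
  have ylr : y \in `]l, r[%R.
    have := phiI a; have := phiI b; rewrite !in_itv/= => /andP[_ br] /andP[la _].
    by rewrite (lt_trans la ay) (le_lt_trans yb br).
  by split; rewrite ?in_itv//= -phi_mono -(phi_le _ b) phiK// ay.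
(* Endpoints are null, so both integrals pass to the closed intervals of the substitution rule. *)
rewrite !integral_itv_obnd_cbnd; first last.
- exact: measurable_funTS.
- apply: measurable_funS mg => // y /=; rewrite !in_itv/= => /andP[ay yb].
  have := phiI a; have := phiI b; rewrite !in_itv/= => /andP[_ br] /andP[la _].
  by rewrite (lt_trans la ay) (le_lt_trans yb br).
rewrite (@integration_by_substitution_increasing _ phi g a b)//.
- exact: ltW.
- by move=> x y _ _; exact: phi_incr.
- by apply/cvg_ex; eexists; exact/cvg_at_right_filter/cphi'.
- by apply/cvg_ex; eexists; exact/cvg_at_left_filter/cphi'.
- split => //.
  + exact/cvg_at_right_filter/phi_cont.
  + exact/cvg_at_left_filter/phi_cont.
- apply: continuous_in_subspaceT => y /set_mem /=; rewrite in_itv/= => /andP[ay yb].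
  apply: cg.
  have := phiI a; have := phiI b; rewrite !in_itv/= => /andP[_ br] /andP[la _].
  by rewrite (lt_le_trans la ay) (le_lt_trans yb br).
Qed.

(* The measures [m1] and [m2] agree on the intervals ]a, b], where the
   substitution rule for continuous integrands applies, hence on [phi @^-1` A]. *)
Lemma integral_change_of_variables (A : set R) : measurable A ->
  (\int[mu]_(y in A `&` `]l, r[) (g y)%:E =
   \int[mu]_(x in phi @^-1` A) (h x)%:E)%E.
Proof.
move=> mA; rewrite -/(m1 (phi @^-1` A)).
have mB : measurable (phi @^-1` A).
  rewrite -[X in measurable X]setTI.
  exact: (continuous_measurable_fun phi_cont).
pose M1 : {measure set (measurableTypeR R) -> \bar R} :=
  HB.pack m1 (isMeasure.Build _ _ _ m1 m1_0 m1_ge0 m1_sadd).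
pose M2 : {measure set (measurableTypeR R) -> \bar R} :=
  HB.pack m2 (isMeasure.Build _ _ _ m2 m2_0 m2_ge0 m2_sadd).
rewrite -[RHS]/(M1 _).
(* The half-open intervals form a generating pi-system. The sets ]-k, k] exhaust the line and have
   finite mass, [h] being continuous on the compact [-k, k]. *)
rewrite (@measure_unique _ _ (measurableTypeR R) (@ocitv R)
  (fun k => `]- k%:R, k%:R]) _ _ _ _ M1 M2)//.
- rewrite /= /m2; congr (integral _ _ _); apply/seteqP; split => y /= [].
    by move=> Ay ylr; split => //; rewrite phiK.
  by move=> ylr; rewrite phiK.
- exact: ocitvI.
- by move=> k; exact: is_ocitv.
- rewrite -subTset => x _; exists (Num.truncn `|x|).+1 => //=.
  rewrite in_itv/=.
  have xk : `|x| < (Num.truncn `|x|).+1%:R by exact: truncnS_gt.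
  by move: xk; rewrite ltr_norml => /andP[-> /ltW].
- by move=> X /ocitvP[->|[[a b] /= ab ->]]; [rewrite !measure0|exact: m12_itv].
- move=> k; rewrite -ge0_fin_numE//; apply: integrable_fin_num => //.
  have : mu.-integrable `[- k%:R, k%:R] (EFin \o h).
    apply: continuous_compact_integrable; first exact: segment_compact.
    exact: continuous_subspaceT.
  by apply: integrableS => //; exact: subset_itv_oc_cc.
Qed.

End change_of_variables.

(** * Closed forms of the Gegenbauer and relativistic Hermite polynomials *)

Section densities.
Context {R : realType}.
Implicit Types (N nu x y : R) (n : nat).

(** [alpha_geg] and the sign cancel the constant of [rodrigues_ultraspherical] up to 1 / n!, and the
    powers of 1 - y^2 cancel each other. *)
Lemma gegenbauerE nu n y : 0 < nu -> 0 < 1 - y ^+ 2 ->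
  gegenbauer n nu y = ultraspherical nu n y / n`!%:R.
Proof.
move=> nu0 y1; rewrite /gegenbauer.
rewrite (_ : (fun t => _) =
    (fun t : R => (1 + t ^+ 2 * -1) `^ (n%:R + nu - 1 / 2))); last first.
  by apply/funext => t; rewrite mulrN1.
rewrite derive1n_powR_quadratic ?mulrN1// rodrigues_ultraspherical// mulrA.
have -> : n%:R + nu - 1 / 2 - n%:R = - (1 / 2 - nu) by ring.
rewrite powRN -[alpha_geg _ _ * _ * _ / _]mulrA divff ?gt_eqF ?powR_gt0//.
rewrite mulr1 /alpha_geg.
have -> : (- 2) ^+ n = (-1) ^+ n * 2 ^+ n :> R by rewrite -exprMn mulN1r.
have p1 : pochhammer (2 * nu) n != 0 by rewrite gt_eqF ?pochhammer_gt0 ?mulr_gt0.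
have p2 : pochhammer (nu + 1 / 2) n != 0.
  by rewrite gt_eqF ?pochhammer_gt0 ?addr_gt0 ?divr_gt0.
have f0 : n`!%:R != 0 :> R by rewrite pnatr_eq0 -lt0n fact_gt0.
have t0 : 2 ^+ n != 0 :> R by rewrite expf_neq0.
have u1 : (-1) ^+ n * (-1) ^+ n = 1 :> R by rewrite -exprD addnn -signr_odd odd_double.
move: p1 p2 f0 t0 u1.
move: (pochhammer (2 * nu) n) (pochhammer (nu + 1 / 2) n) n`!%:R (2 ^+ n)
  ((-1) ^+ n) (ultraspherical nu n y) => a b c d e f p1 p2 f0 t0 u1.
(* The two signs are isolated as [e * e], because [field] does not know that it equals 1. *)
transitivity ((e * e) * f / c); last by rewrite u1 mul1r.
by field; rewrite p1 f0 p2 t0.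
Qed.

(** [rodrigues_homogeneous] with q = 1 / sqrt N and r = sqrt (1 + x^2 / N): the powers of the
    quadratic cancel, and (-1)^n absorbs the sign of - q r. *)
Lemma relHermiteE N n x : 0 < N ->
  relHermite N n x = (Num.sqrt (1 + x ^+ 2 / N) / Num.sqrt N) ^+ n
    * ultraspherical N n (x / Num.sqrt N / Num.sqrt (1 + x ^+ 2 / N)).
Proof.
move=> N0; rewrite /relHermite.
have W0 : 0 < 1 + x ^+ 2 / N.
  by rewrite ltr_pwDl// mulr_ge0 ?sqr_ge0// invr_ge0 ltW.
rewrite derive1n_powR_quadratic// -opprD powRN mulrA.
rewrite -[_ * _ / _]mulrA divff ?gt_eqF ?powR_gt0// mulr1.
have qN : (Num.sqrt N)^-1 ^+ 2 = N^-1 by rewrite exprVn sqr_sqrtr ?ltW.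
rewrite -[X in rodrigues _ X]qN (@rodrigues_homogeneous _ _ _ (Num.sqrt (1 + x ^+ 2 / N))).
- by rewrite mulrA -exprMn mulN1r opprK [_^-1 * _]mulrC.
- by rewrite gt_eqF ?sqrtr_gt0.
- by rewrite qN sqr_sqrtr ?ltW.
Qed.

Lemma ultraspherical_continuous nu n : continuous (ultraspherical nu n).
Proof.
suff : continuous (ultraspherical nu n) /\ continuous (ultraspherical nu n.+1).
  by case.
elim: n => [|n [IH0 IH1]].
  split; first exact: cst_continuous.
  by move=> y; apply: cvgM; [exact: cvg_cst|exact: cvg_id].
split=> // y; apply: cvgB; last first.
  by apply: cvgM; [exact: cvg_cst|exact: IH0].
apply: cvgM; last exact: IH1.
by apply: cvgM; [exact: cvg_cst|exact: cvg_id].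
Qed.

End densities.

(** * The map onto ]-1, 1[ and the relation between the two densities *)

Section substitution.
Context {R : realType}.
Variables (N : R) (n : nat).
Hypothesis N_gt0 : 0 < N.
Implicit Types (x y : R).

Definition to_unit_interval x : R :=
  x / Num.sqrt N / Num.sqrt (1 + x ^+ 2 / N).
(* Inverse of [to_unit_interval] on ]-1, 1[; elsewhere the base of the power
   is not positive and the value is meaningless. *)
Definition of_unit_interval y : R :=
  Num.sqrt N * (y * (1 + y ^+ 2 * -1) `^ (- 2^-1)).
Local Notation phi := to_unit_interval.
Local Notation psi := of_unit_interval.

Let sN_gt0 : 0 < Num.sqrt N. Proof. by rewrite sqrtr_gt0. Qed.
Let sN_neq0 : Num.sqrt N != 0. Proof. by rewrite gt_eqF. Qed.
Let sNK : Num.sqrt N ^+ 2 = N. Proof. by rewrite sqr_sqrtr ?ltW. Qed.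

Let W_gt0 x : 0 < 1 + x ^+ 2 / N.
Proof. by rewrite ltr_pwDl// mulr_ge0 ?sqr_ge0// invr_ge0 ltW. Qed.

Lemma onem_to_unit_interval_sqr x : 1 - phi x ^+ 2 = (1 + x ^+ 2 / N)^-1.
Proof.
rewrite /phi !exprMn !exprVn sNK sqr_sqrtr ?ltW//.
have xN : N + x ^+ 2 != 0 by rewrite gt_eqF// ltr_wpDr ?sqr_ge0.
by field; rewrite xN gt_eqF.
Qed.

Let itv1E y : (y \in `]-1, 1[%R) = (0 < 1 - y ^+ 2).
Proof. by rewrite in_itv/= -ltr_norml subr_gt0 -real_normK ?num_real// expr_lt1. Qed.

Let phiI x : phi x \in `]-1, 1[%R.
Proof. by rewrite itv1E onem_to_unit_interval_sqr invr_gt0. Qed.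

Lemma of_unit_intervalK : {in `]-1, 1[%R, cancel psi phi}.
Proof.
move=> y; rewrite itv1E => y1.
have s_gt0 : 0 < Num.sqrt (1 - y ^+ 2) by rewrite sqrtr_gt0.
have psiE : psi y = Num.sqrt N * y / Num.sqrt (1 - y ^+ 2).
  by rewrite /psi mulrN1 powRN powR12_sqrt ?ltW// mulrA.
rewrite /phi psiE.
have -> : 1 + (Num.sqrt N * y / Num.sqrt (1 - y ^+ 2)) ^+ 2 / N =
    (Num.sqrt (1 - y ^+ 2))^-1 ^+ 2.
  rewrite !exprMn !exprVn sNK sqr_sqrtr ?ltW//.
  by field; rewrite !gt_eqF.
rewrite sqrtr_sqr gtr0_norm ?invr_gt0//.
by field; rewrite sN_neq0 gt_eqF.
Qed.

Let measurable_psi : measurable_fun (`]-1, 1[ : set R) psi.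
Proof.
apply: open_continuous_measurable_fun; first exact: interval_open.
move=> y /set_mem /= yI; have : 0 < 1 + y ^+ 2 * -1 by rewrite mulrN1 -itv1E.
move=> /(continuous_powR_quadratic (- 2^-1) (-1) y) cy.
by apply: cvgM; [exact: cvg_cst|apply: cvgM; [exact: cvg_id|exact: cy]].
Qed.

Let scaleE (a b : R) : a *: b = a * b. Proof. by []. Qed.

Let is_derive_phi x :
  is_derive x 1 phi ((Num.sqrt N)^-1 * (1 + x ^+ 2 / N) `^ (- (3 / 2))).
Proof.
rewrite (_ : phi = (Num.sqrt N)^-1 *:
    ((@id R : R -> R) * (fun x => (1 + x ^+ 2 / N) `^ (- 2^-1)))); last first.
  apply/funext => t.
  rewrite !fctE scaleE powRN powR12_sqrt ?ltW//.
  by rewrite mulrA [X in _ = X / _]mulrC.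
have h := is_deriveZ (Num.sqrt N)^-1 (is_deriveM (is_derive_id x 1)
  (is_derive_powR_quadratic (- 2^-1) _ _ (W_gt0 x))).
apply: (is_derive_eq h); rewrite !scaleE.
have -> : - 2^-1 - 1 = - (3 / 2) :> R by field.
(* With w = 1 + x^2 / N, factoring out w^(-3/2) leaves w - x^2 / N = 1. *)
have -> : (1 + x ^+ 2 / N) `^ (- 2^-1) =
    (1 + x ^+ 2 / N) * (1 + x ^+ 2 / N) `^ (- (3 / 2)).
  rewrite -[X in X * _ `^ _]powRr1 ?(ltW (W_gt0 x))// -powRD.
    by congr (_ `^ _); field.
  by apply/implyP => _; rewrite gt_eqF.
by move: (_ `^ _) => w; field; rewrite sN_neq0 gt_eqF.
Qed.

Let derive1_phi :
  derive1 phi = fun x => (Num.sqrt N)^-1 * (1 + x ^+ 2 / N) `^ (- (3 / 2)).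
Proof. by apply/funext => x; have d := is_derive_phi x; rewrite derive1E derive_val. Qed.

Lemma to_unit_interval_continuous : continuous phi.
Proof.
move=> x; have d := is_derive_phi x.
exact/differentiable_continuous/derivable1_diffP.
Qed.

(** Trades the iterated derivative for a polynomial, which makes continuity on ]-1, 1[
    accessible. *)
Lemma g_densE y : y \in `]-1, 1[%R -> g_dens n N y =
  (1 + y ^+ 2 * -1) `^ (N - 1 / 2) * (ultraspherical N n y / n`!%:R) ^+ 2.
Proof. by rewrite itv1E => y1; rewrite /g_dens gegenbauerE// mulrN1. Qed.

(** In the constant, (n!)^2 undoes the Gegenbauer normalization, N^n comes from the squared Hermite
    polynomial, and sqrt N offsets the 1 / sqrt N in the derivative of [phi]. *)
Lemma f_densE x : f_dens n N x =
  n`!%:R ^+ 2 * Num.sqrt N / N ^+ n * (g_dens n N (phi x) * derive1 phi x).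
Proof.
rewrite g_densE// mulrN1 onem_to_unit_interval_sqr derive1_phi /f_dens relHermiteE//.
rewrite -/(phi x).
set W := 1 + x ^+ 2 / N.
have W0 : 0 < W by exact: W_gt0.
rewrite -(powR_inv1 (ltW W0)) -powRrM [in LHS]exprMn.
have -> : (Num.sqrt W / Num.sqrt N) ^+ n ^+ 2 = W ^+ n / N ^+ n.
  by rewrite exprAC expr_div_n sNK sqr_sqrtr ?ltW// expr_div_n.
have pD s t : W `^ (s + t) = W `^ s * W `^ t.
  by apply: powRD; apply/implyP => _; rewrite gt_eqF.
(* The exponent splits into the weight of [g_dens], the Jacobian, and W^(-n), which cancels the W^n
   of the squared Hermite polynomial. *)
have -> : - (N + 1 + n%:R) = -1 * (N - 1 / 2) + - (3 / 2) + - n%:R by field.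
rewrite !pD powR_invn ?ltW//.
have f0 : n`!%:R != 0 :> R by rewrite pnatr_eq0 -lt0n fact_gt0.
have Nn0 : N ^+ n != 0 by rewrite expf_neq0 ?gt_eqF.
have Wn0 : W ^+ n != 0 by rewrite expf_neq0 ?gt_eqF.
move: f0 Nn0 Wn0.
move: (W `^ _) (W `^ _) (W ^+ n) (N ^+ n) n`!%:R (ultraspherical _ _ _).
move=> a b c d e f e0 d0 c0.
by field; rewrite sN_neq0 e0 d0 c0.
Qed.

Lemma integral_f_dens (A : set R) : measurable A ->
  (\int[@lebesgue_measure R]_(x in phi @^-1` A) (f_dens n N x)%:E =
   (n`!%:R ^+ 2 * Num.sqrt N / N ^+ n)%:E *
   \int[@lebesgue_measure R]_(y in A `&` `](-1)%R, 1%R[) (g_dens n N y)%:E)%E.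
Proof.
move=> mA.
pose g y := (1 + y ^+ 2 * -1) `^ (N - 1 / 2) * (ultraspherical N n y / n`!%:R) ^+ 2.
have K0 : 0 <= n`!%:R ^+ 2 * Num.sqrt N / N ^+ n.
  by rewrite !mulr_ge0 ?sqr_ge0 ?invr_ge0 ?exprn_ge0 ?ltW.
have g0 y : 0 <= g y by rewrite mulr_ge0 ?powR_ge0 ?sqr_ge0.
have dphi0 x : 0 < derive1 phi x.
  by rewrite derive1_phi mulr_gt0 ?invr_gt0 ?powR_gt0.
have cphi' : continuous (derive1 phi).
  rewrite derive1_phi => x; apply: cvgM; first exact: cvg_cst.
  exact: continuous_powR_quadratic.
have dphi x : derivable phi x 1 by have d := is_derive_phi x; exact: ex_derive.
have cphi := to_unit_interval_continuous.
have cg : {in `]-1, 1[%R, continuous g}.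
  move=> y yI; have : 0 < 1 + y ^+ 2 * -1 by rewrite mulrN1 -itv1E.
  move=> /(continuous_powR_quadratic (N - 1 / 2) (-1) y) cy.
  have cu : (ultraspherical N n x / n`!%:R) @[x --> y] -->
      ultraspherical N n y / n`!%:R.
    by apply: cvgM; [exact: ultraspherical_continuous|exact: cvg_cst].
  by apply: cvgM; [exact: cy|apply: cvgM; exact: cu].
have -> : (\int[@lebesgue_measure R]_(y in A `&` `](-1)%R, 1%R[) (g_dens n N y)%:E =
    \int[@lebesgue_measure R]_(y in A `&` `](-1)%R, 1%R[) (g y)%:E)%E.
  by apply: eq_integral => y /set_mem [_ yI]; rewrite g_densE.
rewrite (@integral_change_of_variables _ phi psi g)//; last first.
  exact: of_unit_intervalK.
rewrite -ge0_integralZl//.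
- by apply: eq_integral => x _; rewrite f_densE g_densE// -EFinM.
- by rewrite -[X in measurable X]setTI; exact: continuous_measurable_fun.
- apply: measurable_funTS; apply/measurable_EFinP.
  apply: continuous_measurable_fun.
  move=> x; apply: cvgM; last exact: cphi'.
  by apply: (@continuous_comp _ _ _ phi g); [exact: cphi|exact: cg].
- by move=> x _; rewrite lee_fin mulr_ge0// ltW.
Qed.

End substitution.

Theorem theorem4 (R : realType) (N : R) (n : nat)
  (d : measure_display) (T : measurableType d) (P : probability T R)
  (X : T -> R) :
  0 < N ->
  measurable_fun setT X ->
  (exists c : R, 0 < c /\
     forall A : set R, measurable A ->
       P (X @^-1` A) =
       (c%:E * \int[@lebesgue_measure R]_(x in A) (f_dens n N x)%:E)%E) ->
  let Y := fun t : T =>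
    (X t / Num.sqrt N) / Num.sqrt (1 + X t ^+ 2 / N) in
  let I : set R := `]-1, 1[%classic in
  exists c' : R, 0 < c' /\
     forall A : set R, measurable A ->
       P (Y @^-1` A) =
       (c'%:E * \int[@lebesgue_measure R]_(y in A `&` I)
                   (g_dens n N y)%:E)%E.
Proof.
move=> N0 mX [c [c0 PX]] Y I.
(* The constant of [X] times the factor of [integral_f_dens]. *)
exists (c * (n`!%:R ^+ 2 * Num.sqrt N / N ^+ n)); split.
  by rewrite mulr_gt0// divr_gt0 ?mulr_gt0 ?exprn_gt0 ?sqrtr_gt0 ?ltr0n ?fact_gt0.
(* Since Y is [to_unit_interval] after X, the preimage of [A] under Y is the preimage under X of a
   set that is measurable by continuity of that map. *)
move=> A mA; rewrite EFinM -muleA -integral_f_dens// -PX//.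
rewrite -[X in measurable X]setTI; apply: continuous_measurable_fun => //.
exact: to_unit_interval_continuous.
Qed.
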